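(* Let $S$ be an integral domain which is not a field, let $F$ be its field of fractions, and let $A \neq F$ be an $F$-algebra having an $S$-stable basis over $F$. Then there is no minimal (with respect to inclusion) $S$-nice subalgebra of $A$; that is, for every $S$-nice subalgebra $R$ of $A$ there exists an $S$-nice subalgebra $R'$ of $A$ with $R' \subsetneq R$.
   Context: Algebras are associative, unital and nonzero, not necessarily commutative, and $A$ may be infinite dimensional over $F$; $F$ is identified with $F\cdot 1_A \subseteq A$. A basis $B$ of $A$ over $F$ is called $S$-stable if there exists a basis $C$ of $A$ over $F$ such that for all $c \in C$ and $b \in B$ one has $cb \in \sum_{y \in B} Sy$. An $S$-subalgebra $R$ of $A$ is called an $S$-nice subalgebra of $A$ if $R \cap F = S$ and $RF = A$, where $RF$ is the $F$-subspace of $A$ spanned by $R$. *)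

(* Defs.v *)
From mathcomp Require Import all_boot all_order all_algebra.
From mathcomp Require Import boolp classical_sets.
Set Implicit Arguments.
Unset Strict Implicit.
Unset Printing Implicit Defensive.
Import GRing.Theory.
Local Open Scope classical_set_scope.
Local Open Scope ring_scope.

(* [span_by f X] is the set of finite sums of f(k) x with k in K and x in X;
   K acts on A through f. *)
Definition span_by (K : choiceType) (F : fieldType) (A : lmodType F) (f : K -> F)
    (X : set A) : set A :=
  [set v | exists s : seq (K * A),
    (forall p, p \in s -> X p.2) /\ v = \sum_(p <- s) f p.1 *: p.2].

Definition lin_indep (F : fieldType) (A : lmodType F) (X : set A) : Prop :=
  forall (s : seq A) (c : A -> F), uniq s -> (forall x, x \in s -> X x) ->
    \sum_(x <- s) c x *: x = 0 -> forall x, x \in s -> c x = 0.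

(* Hamel bases: the set X may be infinite. *)
Definition is_basis (F : fieldType) (A : lmodType F) (X : set A) : Prop :=
  lin_indep X /\ span_by (@id F) X = [set: A].

Definition S_stable_basis (S : idomainType) (A : algType {fraction S})
    (B : set A) : Prop :=
  is_basis B /\
  exists C : set A, is_basis C /\
    forall c b, C c -> B b -> span_by (@tofrac S) B (c * b).

(* A is an S-algebra by restriction of scalars along S -> {fraction S}. *)
Definition S_subalgebra (S : idomainType) (A : algType {fraction S})
    (R : set A) : Prop :=
  subring_closed (mem R) /\ forall (s : S) (x : A), R x -> R (tofrac s *: x).

Definition S_nice (S : idomainType) (A : algType {fraction S})
    (R : set A) : Prop :=
  [/\ S_subalgebra R,
      R `&` range (in_alg A) = range (fun s : S => (tofrac s)%:A)
    & span_by (@id {fraction S}) R = [set: A]].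

(* Main.v *)
(** Let [M] be the [S]-span of the stable basis and [N] the ring of all [a] in [A]
    with [a M] contained in [M]; stability gives [N F = A]. If [R] is not
    contained in [N], then the intersection of [R] and [N] is a smaller nice
    subalgebra. Otherwise [S + s R] is nice for each nonzero [s] in [S], and it
    cannot be equal to [R] for all [s]: every [r] in [R] would then act on [M] as
    a scalar modulo [s] for every [s], hence as a scalar because [S] is not a
    field, and [A = R F] would be [F]. *)
Require Import Defs.
From mathcomp Require Import all_boot all_order all_algebra.
From mathcomp Require Import boolp classical_sets.
Import GRing.Theory.
Local Open Scope classical_set_scope.
Local Open Scope ring_scope.

(** * Clearing denominators, and subrings given as sets *)

Lemma tofrac_denom (S : idomainType) (x : {fraction S}) :
  exists d n : S, d != 0 /\ tofrac d * x = tofrac n.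
Proof.
elim/quotW: x => r; exists (\d_r), (\n_r); split; first exact: denom_ratioP.
(* Exposing the product of classes lets [piE] pass to representatives, where equality becomes a
   cross product in [S]. *)
rewrite -[LHS]/(FracField.mul _ _) !piE; apply/eqmodP => /=.
rewrite FracField.equivfE /FracField.mulf.
by rewrite !numden_Ratio ?mul1r ?mulr1 ?oner_neq0 ?denom_ratioP // mulrC.
Qed.

Lemma subring_closed_setP (A : pzRingType) (R : set A) :
  GRing.subring_closed (mem R) <->
  [/\ R 1, forall x y, R x -> R y -> R (x - y)
    & forall x y, R x -> R y -> R (x * y)].
Proof.
split=> -[R1 RB RM]; split.
- by have := R1; rewrite inE.
- by move=> x y /mem_set Rx /mem_set Ry; have := RB x y Rx Ry; rewrite inE.
- by move=> x y /mem_set Rx /mem_set Ry; have := RM x y Rx Ry; rewrite inE.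
- by rewrite inE.
- by move=> x y /set_mem Rx /set_mem Ry; apply/mem_set/RB.
- by move=> x y /set_mem Rx /set_mem Ry; apply/mem_set/RM.
Qed.

(** * Spans with coefficients in a ring mapping to [F] *)

Section SpanBy.
Set Implicit Arguments.
Unset Strict Implicit.
Variables (F : fieldType) (A : lmodType F).

Lemma span_by_ind (K : choiceType) (f : K -> F) (X P : set A) :
  P 0 -> (forall k x v, X x -> P v -> P (f k *: x + v)) -> span_by f X `<=` P.
Proof.
move=> P0 PD v [s [sX ->]]; elim: s sX => [|p s IH] sX; first by rewrite big_nil.
rewrite big_cons; apply: PD; first by apply: sX; rewrite mem_head.
by apply: IH => q qs; apply: sX; rewrite in_cons qs orbT.
Qed.

Lemma span_by0 (K : choiceType) (f : K -> F) (X : set A) : span_by f X 0.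
Proof. by exists [::]; split => //; rewrite big_nil. Qed.

Lemma span_byD (K : choiceType) (f : K -> F) (X : set A) u v :
  span_by f X u -> span_by f X v -> span_by f X (u + v).
Proof.
move=> [s [sX ->]] [t [tX ->]]; exists (s ++ t); rewrite big_cat; split=> // p.
by rewrite mem_cat => /orP[/sX|/tX].
Qed.

Lemma span_by_scale1 (K : choiceType) (f : K -> F) (X : set A) k x :
  X x -> span_by f X (f k *: x).
Proof.
by move=> Xx; exists [:: (k, x)]; rewrite big_seq1; split=> // p; rewrite inE => /eqP->.
Qed.

Lemma span_by_gen (K : nzRingType) (f : {rmorphism K -> F}) (X : set A) :
  X `<=` span_by f X.
Proof.
by move=> x Xx; rewrite -[x]scale1r -(rmorph1 f); apply: span_by_scale1.
Qed.

Lemma span_byZ (K : nzRingType) (f : {rmorphism K -> F}) (X : set A) k v :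
  span_by f X v -> span_by f X (f k *: v).
Proof.
move: v; apply: span_by_ind; first by rewrite scaler0; apply: span_by0.
move=> l x v Xx Xv; rewrite scalerDr scalerA -rmorphM; apply: span_byD => //.
exact: span_by_scale1.
Qed.

End SpanBy.

(** * Coordinates and dual functionals of a Hamel basis *)

Section Coordinates.
Set Implicit Arguments.
Unset Strict Implicit.
Variables (F : fieldType) (A : lmodType F) (B : set A).

(** Since [f] is total and vanishes off a finite list, coordinates of vectors with different
    supports combine pointwise. *)
Definition coords_of (a : A) (f : A -> F) : Prop :=
  exists s : seq A, [/\ uniq s, forall x, x \in s -> B x,
    forall x, x \notin s -> f x = 0 & a = \sum_(x <- s) f x *: x].

Lemma sum_support_widen (f : A -> F) (s t : seq A) :
  uniq s -> uniq t -> {subset s <= t} -> (forall x, x \notin s -> f x = 0) ->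
  \sum_(x <- t) f x *: x = \sum_(x <- s) f x *: x.
Proof.
move=> us ut st f0; rewrite (bigID (mem s)) /= [X in _ + X]big1 ?addr0; last first.
  by move=> x /f0->; rewrite scale0r.
rewrite -big_filter; apply: perm_big; apply: uniq_perm; rewrite ?filter_uniq //.
by move=> x; rewrite mem_filter; case: (boolP (x \in s)) => // /st->.
Qed.

Lemma coords_of_linear k a b f g :
  coords_of a f -> coords_of b g -> coords_of (k *: a + b) (fun x => k * f x + g x).
Proof.
move=> [s [us sB f0 ->]] [t [ut tB g0 ->]].
exists (undup (s ++ t)); split; first exact: undup_uniq.
- by move=> x; rewrite mem_undup mem_cat => /orP[/sB|/tB].
- move=> x; rewrite mem_undup mem_cat negb_or => /andP[/f0-> /g0->].
  by rewrite mulr0 addr0.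
rewrite -(@sum_support_widen f s (undup (s ++ t))) ?undup_uniq //; last first.
  by move=> x xs; rewrite mem_undup mem_cat xs.
rewrite -(@sum_support_widen g t (undup (s ++ t))) ?undup_uniq //; last first.
  by move=> x xs; rewrite mem_undup mem_cat xs orbT.
rewrite scaler_sumr -big_split; apply: eq_bigr => x _ /=.
by rewrite scalerDl scalerA.
Qed.

Lemma coords_of_basis b : B b -> coords_of b (fun x => (x == b)%:R).
Proof.
move=> Bb; exists [:: b]; split=> //.
- by move=> x; rewrite inE => /eqP->.
- by move=> x; rewrite inE => /negPf->.
- by rewrite big_seq1 eqxx scale1r.
Qed.

Lemma coords_of0 : coords_of 0 (fun=> 0).
Proof. by exists [::]; split=> //; rewrite big_nil. Qed.

Lemma coords_of_zero f : lin_indep B -> coords_of 0 f -> f =1 fun=> 0.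
Proof.
move=> indB [s [us sB f0 /esym e0]] x.
by case: (boolP (x \in s)) => [|/f0 //]; apply: indB x.
Qed.

Lemma coords_of_uniq a f g :
  lin_indep B -> coords_of a f -> coords_of a g -> f =1 g.
Proof.
move=> indB af ag x; have := coords_of_linear (-1) af ag.
rewrite scaleN1r addNr => /(coords_of_zero indB)/(_ x)/eqP.
by rewrite mulN1r addrC subr_eq0 eq_sym => /eqP.
Qed.

Lemma coords_of_exists a : span_by id B a -> exists f, coords_of a f.
Proof.
move: a; apply: span_by_ind; first by exists (fun=> 0); apply: coords_of0.
move=> k x v Bx [g vg]; exists (fun y => k * (y == x)%:R + g y).
exact/coords_of_linear/vg/coords_of_basis.
Qed.

(** Coordinates are picked by choice; their uniqueness makes each functional linear. *)
Lemma basis_dual : is_basis B -> exists phi : A -> A -> F,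
  [/\ forall b k u v, phi b (k *: u + v) = k * phi b u + phi b v,
      forall b c, B b -> phi c b = (c == b)%:R
    & forall a, (forall b, B b -> phi b a = 0) -> a = 0].
Proof.
move=> [indB spanB].
have /choice[co coP] : forall a, exists f, coords_of a f.
  by move=> a; apply: coords_of_exists; rewrite spanB.
exists (fun b a => co a b); split.
- move=> b k u v.
  exact: (coords_of_uniq indB (coP _) (coords_of_linear k (coP u) (coP v))).
- move=> b c Bb; exact: (coords_of_uniq indB (coP b) (coords_of_basis Bb)).
- move=> a a0; have [s [_ sB _ ->]] := coP a; rewrite big_seq big1 // => x xs.
  by rewrite a0 ?scale0r //; apply: sB.
Qed.

End Coordinates.

(** * Nice subalgebras and their two ways of shrinking *)

Section Nice.
Set Implicit Arguments.
Unset Strict Implicit.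
Variables (S : idomainType) (A : algType {fraction S}).
Implicit Types R B : set A.

(** If [x] were nonzero, divisibility by [x * u] would give [x = x * u * y]; cancelling [x] makes
    every nonzero [u] a unit. *)
Lemma divisible_eq0 (x : S) : ~ GRing.field_axiom S ->
  (forall s, s != 0 -> exists y, x = s * y) -> x = 0.
Proof.
move=> nf xdiv; apply/eqP; apply: contra_notT nf => x0 u u0.
have [y xE] : exists y, x = x * u * y by apply: xdiv; rewrite mulf_neq0.
apply/unitrPr; exists y; apply: (mulfI x0).
by rewrite mulr1 mulrA -xE.
Qed.

(** As -1 comes from [S], scaling yields opposites, so sums can replace differences. *)
Lemma S_subalgebraP R : S_subalgebra R <->
  [/\ R 1, forall x y, R x -> R y -> R (x + y),
      forall x y, R x -> R y -> R (x * y)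
    & forall s x, R x -> R (tofrac s *: x)].
Proof.
split=> [[/subring_closed_setP[R1 RB RM] RZ]|[R1 RD RM RZ]].
  split=> // x y Rx Ry; rewrite -[y]opprK; apply: RB => //.
  by rewrite -scaleN1r -tofrac1 -tofracN; apply: RZ.
split=> //; apply/subring_closed_setP; split=> // x y Rx Ry.
by apply: RD => //; rewrite -scaleN1r -tofrac1 -tofracN; apply: RZ.
Qed.

Lemma S_subalgebra_span R : S_subalgebra R ->
  span_by (@id {fraction S}) R = [set: A] <->
  forall a, exists2 d : S, d != 0 & R (tofrac d *: a).
Proof.
move=> /S_subalgebraP[R1 RD _ RZ]; split=> [spanR a|Rden].
  have : span_by id R a by rewrite spanR.
  move: a; apply: span_by_ind.
    exists 1; rewrite ?oner_neq0 // scaler0.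
    by rewrite -(scale0r 1) -tofrac0; apply: RZ.
  move=> k x v Rx [e e0 Rv]; have [d [n [d0 dk]]] := tofrac_denom _ k.
  (* With [d k = n] in [S], one has [(d e)(k x + v) = n (e x) + d (e v)]. *)
  exists (d * e); first exact: mulf_neq0.
  rewrite scalerDr scalerA tofracM mulrAC dk -!scalerA.
  by apply: RD; [apply/RZ/RZ|apply: RZ].
apply/seteqP; split=> // a _; have [d d0 Rda] := Rden a.
have -> : a = (tofrac d)^-1 *: (tofrac d *: a).
  by rewrite scalerA mulVf ?scale1r // tofrac_eq0.
exact: span_by_scale1.
Qed.

Lemma S_niceP R : S_nice R <->
  [/\ S_subalgebra R,
      forall k, R k%:A -> exists s : S, k = tofrac s
    & forall a, exists2 d : S, d != 0 & R (tofrac d *: a)].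
Proof.
split=> -[Rsub RF /(S_subalgebra_span Rsub)spanR].
  split=> // k Rk.
  have : (R `&` range (in_alg A)) k%:A by split=> //; exists k.
  (* Because 1 is nonzero in [A], the embedding of the scalars is injective. *)
  rewrite RF => -[s _ /eqP]; rewrite -subr_eq0 -scalerBl scaler_eq0 oner_eq0.
  by rewrite orbF subr_eq0 => /eqP<-; exists s.
split=> //; apply/seteqP; split.
  by move=> x [Rx [k _ kx]]; move: Rx; rewrite -kx => /RF[s ->]; exists s.
move=> _ [s _ <-]; split; last by exists (tofrac s).
by have /S_subalgebraP[R1 _ _ RZ] := Rsub; apply: RZ.
Qed.


Definition lattice_stabilizer B : set A :=
  [set a | forall m, span_by (@tofrac S) B m -> span_by (@tofrac S) B (a * m)].

Lemma lattice_stabilizer_S_subalgebra B : S_subalgebra (lattice_stabilizer B).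
Proof.
apply/S_subalgebraP; split.
- by move=> m; rewrite mul1r.
- by move=> x y Nx Ny m Mm; rewrite mulrDl; apply: span_byD; [apply: Nx|apply: Ny].
- by move=> x y Nx Ny m Mm; rewrite -mulrA; apply/Nx/Ny.
- by move=> s x Nx m Mm; rewrite -scalerAl; apply/span_byZ/Nx.
Qed.

(** The basis [C] lies in the stabilizer: stability gives [c b] in the lattice for [b] in [B], and
    [S]-linearity extends this to the whole lattice. *)
Lemma lattice_stabilizer_span B :
  S_stable_basis B -> span_by id (lattice_stabilizer B) = [set: A].
Proof.
move=> [_ [C [[_ spanC] CB]]]; apply/seteqP; split=> // a _.
have : span_by id C a by rewrite spanC.
move=> [s [sC ->]]; exists s; split=> // p /sC Cp.
apply: span_by_ind; first by rewrite mulr0; apply: span_by0.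
move=> k b v Bb Mv; rewrite mulrDr -scalerAr; apply: span_byD => //.
by apply: span_byZ; apply: CB.
Qed.

(** Scalars of the intersection are controlled by [R1] alone, and a product of two denominators
    serves both subalgebras. *)
Lemma S_nice_capl R1 R2 : S_nice R1 -> S_subalgebra R2 ->
  span_by id R2 = [set: A] -> S_nice (R1 `&` R2).
Proof.
move=> /S_niceP[/S_subalgebraP[I1 D1 M1 Z1] F1 den1] sub2.
move=> /(S_subalgebra_span sub2) den2; have /S_subalgebraP[I2 D2 M2 Z2] := sub2.
apply/S_niceP; split.
- apply/S_subalgebraP; split=> //.
  + by move=> x y [? ?] [? ?]; split; [apply: D1|apply: D2].
  + by move=> x y [? ?] [? ?]; split; [apply: M1|apply: M2].
  + by move=> s x [? ?]; split; [apply: Z1|apply: Z2].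
- by move=> k [/F1].
- move=> a; have [d d0 Rd] := den1 a; have [e e0 Re] := den2 a.
  exists (d * e); first exact: mulf_neq0.
  split; last by rewrite tofracM -scalerA; apply: Z2.
  by rewrite mulrC tofracM -scalerA; apply: Z1.
Qed.

Definition scalars_plus_scaled (s : S) R : set A :=
  [set x | exists t r, R r /\ x = (tofrac t)%:A + tofrac s *: r].

Lemma S_nice_scalars_plus_scaled s R :
  s != 0 -> S_nice R -> S_nice (scalars_plus_scaled s R).
Proof.
move=> s0 /S_niceP[/S_subalgebraP[I1 D1 M1 Z1] F1 den1].
have R0 : R 0 by rewrite -(scale0r 1) -tofrac0; apply: Z1.
apply/S_niceP; split.
- apply/S_subalgebraP; split.
  + by exists 1, 0; rewrite scaler0 addr0 tofrac1 scale1r.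
  + move=> _ _ [t [x [Rx ->]]] [u [y [Ry ->]]]; exists (t + u), (x + y).
    by split; [apply: D1|rewrite tofracD scalerDl scalerDr addrACA].
  + move=> _ _ [t [x [Rx ->]]] [u [y [Ry ->]]].
    (* Expansion of [(t + s x)(u + s y) = t u + s (t y + u x + s x y)]. *)
    exists (t * u), (tofrac t *: y + (tofrac u *: x + tofrac s *: (x * y))).
    split; first by apply: (D1); [apply: Z1|apply: D1; [apply: Z1|apply/Z1/M1]].
    rewrite mulrDl !mulrDr !mulr_algl -!scalerAl -!scalerAr mulr1 !scalerDr.
    by rewrite !scalerA tofracM [tofrac s * tofrac t]mulrC
      [tofrac s * tofrac u]mulrC !addrA.
  + move=> u _ [t [x [Rx ->]]]; exists (u * t), (tofrac u *: x).
    split; first exact: Z1.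
    by rewrite scalerDr !scalerA tofracM [tofrac s * _]mulrC.
(* If [k = t + s r], then [r] is a scalar in [R], hence comes from some [u] in [S], and
   [k = t + s u] does too. *)
- move=> k [t [r [Rr /eqP]]]; rewrite addrC -subr_eq -scalerBl => /eqP rE.
  have rk : r = ((tofrac s)^-1 * (k - tofrac t))%:A.
    by rewrite -scalerA rE scalerA mulVf ?scale1r // tofrac_eq0.
  rewrite rk in Rr; have [u uE] := F1 _ Rr; exists (t + s * u).
  by rewrite tofracD tofracM -uE mulrA mulfV ?tofrac_eq0 // mul1r subrKC.
- move=> a; have [d d0 Rd] := den1 a; exists (s * d); first exact: mulf_neq0.
  by exists 0, (tofrac d *: a); rewrite tofrac0 scale0r add0r tofracM scalerA.
Qed.

Lemma scalars_plus_scaled_sub s R :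
  S_nice R -> scalars_plus_scaled s R `<=` R.
Proof.
move=> /S_niceP[/S_subalgebraP[I1 D1 M1 Z1] _ _] _ [t [r [Rr ->]]].
by apply: D1; apply: Z1.
Qed.

(* Reducing modulo every nonzero [s] at once, the matrix of [r] in the basis [B]
   has entries in [S] whose off-diagonal terms and differences of diagonal terms
   are divisible by all nonzero elements of [S], hence vanish. *)
Lemma lattice_stabilizer_scalar B r :
  ~ GRing.field_axiom S -> is_basis B ->
  (forall s, s != 0 -> scalars_plus_scaled s (lattice_stabilizer B) r) ->
  range (in_alg A) r.
Proof.
move=> nf basisB rdiv; have [phi [phiL phiB phi0]] := basis_dual basisB.
have phi00 b : phi b 0 = 0.
  by have := phiL b (-1) 0 0; rewrite scaler0 addr0 mulN1r addNr.
have phiZ b k v : phi b (k *: v) = k * phi b v.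
  by rewrite -[k *: v]addr0 phiL phi00 addr0.
have phiD b u v : phi b (u + v) = phi b u + phi b v.
  by rewrite -{1}[u]scale1r phiL mul1r.
have phiM b m : span_by (@tofrac S) B m -> exists y : S, phi b m = tofrac y.
  move: m; apply: span_by_ind; first by exists 0; rewrite phi00 tofrac0.
  move=> k x v Bx [y vy]; exists (k * (b == x)%:R + y).
  by rewrite phiL vy phiB // tofracD tofracM rmorph_nat.
(* One [t], depending on [s] only, serves all entries; this uniformity is what allows diagonal
   entries to be compared. *)
have entryE s : s != 0 -> exists t : S, forall b c, B b -> B c ->
    exists y : S, phi c (r * b) = tofrac (t * (c == b)%:R + s * y).
  move=> /rdiv[t [m [Nm ->]]]; exists t => b c Bb Bc.
  have [y yE] : exists y : S, phi c (m * b) = tofrac y.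
    by apply: phiM; apply: Nm; apply: span_by_gen.
  exists y; rewrite mulrDl -!scalerAl mul1r phiD !phiZ yE phiB //.
  by rewrite tofracD !tofracM rmorph_nat.
have entryS b c : B b -> B c -> exists y : S, phi c (r * b) = tofrac y.
  (* Taking [s = 1] just records that the entries lie in [S]. *)
  move=> Bb Bc; have [t tE] := entryE 1 (oner_neq0 _).
  by have [y ->] := tE b c Bb Bc; eexists.
have offdiag b c : B b -> B c -> c != b -> phi c (r * b) = 0.
  move=> Bb Bc /negPf cb; have [x xE] := entryS b c Bb Bc.
  rewrite xE (divisible_eq0 nf (x := x)) ?tofrac0 // => s s0.
  have [t /(_ b c Bb Bc)[y]] := entryE s s0.
  by rewrite xE cb mulr0 add0r => /eqP; rewrite tofrac_eq => /eqP; exists y.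
have diag b c : B b -> B c -> phi b (r * b) = phi c (r * c).
  move=> Bb Bc; have [x xE] := entryS b b Bb Bb; have [z zE] := entryS c c Bc Bc.
  (* The common [t] cancels in the difference, leaving [s * (y - w)]. *)
  rewrite xE zE; congr tofrac; apply/eqP; rewrite -subr_eq0; apply/eqP.
  apply: divisible_eq0 => // s s0; have [t tE] := entryE s s0.
  have [y] := tE b b Bb Bb; rewrite xE => /eqP; rewrite tofrac_eq => /eqP->.
  have [w] := tE c c Bc Bc; rewrite zE => /eqP; rewrite tofrac_eq => /eqP->.
  by exists (y - w); rewrite !eqxx opprD addrACA subrr add0r mulrBr.
have [k kE] : exists k, forall b, B b -> r * b = k *: b.
  (* The scalar is any one diagonal entry, or 0 by default if [B] is empty. *)
  have [[b0 B0]|B0] := pselect (exists b, B b); last first.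
    by exists 0 => b Bb; case: B0; exists b.
  exists (phi b0 (r * b0)) => b Bb; apply/eqP; rewrite -subr_eq0; apply/eqP.
  apply: phi0 => c Bc; rewrite -scaleNr addrC phiL (phiB b c Bb).
  have [->|cb] := eqVneq c b; last by rewrite (offdiag b c) // mulr0 addr0.
  by rewrite (diag b b0) //= mulr1 addNr.
have rE a : r * a = k *: a.
  have : span_by id B a by rewrite basisB.2.
  move: a; apply: span_by_ind; first by rewrite mulr0 scaler0.
  move=> l b v Bb IH; rewrite mulrDr -scalerAr (kE b Bb) IH scalerDr.
  by rewrite !scalerA mulrC.
(* Evaluating at 1 turns the homothety into [r = k]. *)
by exists k => //=; rewrite -rE mulr1.
Qed.

End Nice.

Theorem mainTheorem2 (S : idomainType) (A : algType {fraction S})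
    (S_not_field : ~ GRing.field_axiom S)
    (A_neq_F : range (in_alg A) <> [set: A])
    (A_stable : exists B : set A, S_stable_basis B) :
  forall R : set A, S_nice R -> exists R' : set A, S_nice R' /\ R' `<` R.
Proof.
move=> R niceR; have [B stableB] := A_stable.
have niceRN := S_nice_capl niceR (lattice_stabilizer_S_subalgebra B)
  (lattice_stabilizer_span stableB).
have [RN|RN] := pselect (R `<=` lattice_stabilizer B); last first.
  exists (R `&` lattice_stabilizer B); split=> //; split=> [|RsubRN].
    exact: subIsetl.
  by apply: RN => x /RsubRN[].
(* Without a smaller nice subalgebra, every element of [R] will be a scalar, which forces
   [A = F]. *)
apply: contrapT => noR'; apply: A_neq_F; apply/seteqP; split=> // a _.
have Rscalar r : R r -> range (in_alg A) r.
  move=> Rr; apply: (lattice_stabilizer_scalar S_not_field stableB.1) => s s0.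
  (* Here [R] lies in the stabilizer, so an [r] outside [S + s N] is also outside [S + s R], which
     is then strictly smaller than [R]. *)
  apply: contrapT => rns; apply: noR'; exists (scalars_plus_scaled s R).
  split; first exact: S_nice_scalars_plus_scaled.
  split; first exact: scalars_plus_scaled_sub.
  move=> /(_ r Rr)[t [x [Rx rE]]]; apply: rns; exists t, x; split=> //.
  exact: RN.
have [_ _ spanR] := niceR.
have : span_by id R a by rewrite spanR.
move: a; apply: span_by_ind; first by exists 0 => //=; rewrite scale0r.
move=> k x v /Rscalar[l _ <-] [m _ <-]; exists (k * l + m) => //=.
by rewrite scalerDl scalerA.
Qed.
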